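(* Consider the sets of classical cycles and classical gap vectors, defined respectively by $$\mathbf{Z}=\{\mathbf{x}\in\mathbf{X}: 0\in\partial\mathbf{f}(\mathbf{x})+(\operatorname{Id}-\mathbf{R})\mathbf{x}\},\qquad \mathbf{G}=\{\mathbf{y}\in\mathbf{X}: 0\in(\partial\mathbf{f})^{-1}(\mathbf{y})+(\operatorname{Id}-\mathbf{R})^{-1}\mathbf{y}\}.$$ Then: (i) $\mathbf{Z}=\bigcup_{\mathbf{y}\in\mathbf{G}}\big[(\operatorname{Id}-\mathbf{R})^{-1}(-\mathbf{y})\cap(\partial\mathbf{f})^{-1}(\mathbf{y})\big]$. (ii) $\mathbf{G}=\{\mathbf{R}\mathbf{x}-\mathbf{x}:\mathbf{x}\in\mathbf{Z}\}$. If $\mathbf{G}\neq\varnothing$, then $\mathbf{G}$ is a singleton $\{\mathbf{y}\}$ with $\mathbf{y}\in\Delta^\perp$, and $\mathbf{y}=\mathbf{R}\mathbf{x}-\mathbf{x}$ for every $\mathbf{x}\in\mathbf{Z}$.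
   Context: $X$ is a real Hilbert space, $m\in\{1,2,\dots\}$, $\mathbf{X}=X^m$ is the product Hilbert space, $\mathbf{R}(x_1,\dots,x_m)=(x_m,x_1,\dots,x_{m-1})$, $\Delta=\{(x,\dots,x):x\in X\}$ with orthogonal complement $\Delta^\perp$, and $(\operatorname{Id}-\mathbf{R})^{-1}$ is the set-valued inverse. $f_1,\dots,f_m$ are proper lower semicontinuous convex functions $X\to\,]-\infty,+\infty]$, $\mathbf{f}(x_1,\dots,x_m)=\sum_{i=1}^m f_i(x_i)$, and $\partial$ is the convex subdifferential. Standing assumption: $\operatorname{dom}\mathbf{f}^*\cap\Delta^\perp\neq\varnothing$ ($\mathbf{f}^*$ the Fenchel conjugate). *)

(* Defs.v *)
From HB Require Import structures.
From mathcomp Require Import all_boot all_order all_algebra sesquilinear.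
From mathcomp Require Import all_classical all_reals all_analysis.

Set Implicit Arguments.
Unset Strict Implicit.
Unset Printing Implicit Defensive.

Import Order.TTheory GRing.Theory Num.Theory.
Import numFieldNormedType.Exports.

Local Open Scope classical_set_scope.
Local Open Scope ring_scope.

(* A real Hilbert space is rendered as a completeNormedModType X over a
   realType R together with an inner product dot : {dot X for idfun} such that
   dot x x = `|x| ^+ 2.  The notions below that only use the inner product are
   stated for any real inner product space. *)

Section ConvexAnalysis.
Variables (R : realType) (E : lmodType R).
Implicit Types (dot : {dot E for idfun}) (g : E -> \bar R).

(* g takes its values in ]-oo, +oo] and is not identically +oo *)
Definition proper_fun g :=
  (forall x, g x != -oo%E) /\ exists x, (g x < +oo)%E.

(* Meaningful for functions that do not take the value -oo: no indeterminate
   sum (+oo) + (-oo) then occurs. *)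
Definition econvex_fun g := forall (x y : E) (t : R), 0 < t -> t < 1 ->
  (g (t *: x + (1 - t) *: y)%R <= t%:E * g x + (1 - t)%:E * g y)%E.

Definition edom g : set E := [set x | (g x < +oo)%E].

Definition fenchel_conj dot g : E -> \bar R :=
  fun u => ereal_sup [set ((dot x u)%:E - g x)%E | x in setT].

Definition subdiff dot g : E -> set E :=
  fun x => [set u | forall y, ((dot (y - x) u)%:E + g x <= g y)%E].

Definition ortho_compl dot (A : set E) : set E :=
  [set y | forall x, A x -> dot x y = 0].

End ConvexAnalysis.

Section SetValued.
Variable E : zmodType.

Definition op_inv (A : E -> set E) : E -> set E := fun u => [set x | A x u].

Definition minkowski_sum (A B : set E) : set E :=
  [set a + b | a in A & b in B].

Definition op_of_fun (F : E -> E) : E -> set E := fun x => [set F x].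

End SetValued.

Section ProductSpace.
Variables (R : realType) (X : lmodType R) (m : nat).
Implicit Type dot : {dot X for idfun}.

Definition prod_dot dot (x y : {ffun 'I_m -> X}) : R :=
  \sum_(i < m) dot (x i) (y i).

Lemma prod_dot_bilinear dot :
  bilinear_for *%R (idfun \; *%R) (prod_dot dot).
Proof.
split=> [y k x z|y k x z]; rewrite /prod_dot /= mulr_sumr -big_split /=;
  apply: eq_bigr => i _; rewrite !ffunE.
- by rewrite linearDl linearZl_LR.
- by rewrite linearDr linearZr_LR.
Qed.

HB.instance Definition _ dot :=
  bilinear_isBilinear.Build R {ffun 'I_m -> X} {ffun 'I_m -> X} R
    *%R (idfun \; *%R) (prod_dot dot) (prod_dot_bilinear dot).

Lemma prod_dot_sym dot (x y : {ffun 'I_m -> X}) :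
  prod_dot dot x y = (-1) ^+ false * idfun (prod_dot dot y x).
Proof.
rewrite expr0 mul1r /=; apply: eq_bigr => i _.
by rewrite (hermitian_subproof (s := dot)) expr0 mul1r.
Qed.

HB.instance Definition _ dot :=
  isHermitianSesquilinear.Build R {ffun 'I_m -> X} false idfun
    (prod_dot dot) (prod_dot_sym dot).

Lemma prod_dot_gt0 dot (x : {ffun 'I_m -> X}) : x != 0 -> 0 < prod_dot dot x x.
Proof.
have ge0 (z : X) : 0 <= dot z z.
  have [->|/(neq0_dnorm_gt0 (s := dot))/ltW//] := eqVneq z 0.
  by rewrite linear0r.
move=> x0; have /existsP[i xi0] : [exists i, x i != 0].
  rewrite -negb_forall; apply: contra x0 => /forallP x0.
  by apply/eqP/ffunP => i; rewrite ffunE; apply/eqP/x0.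
rewrite /prod_dot (bigD1 i)//= ltr_wpDr ?sumr_ge0//.
exact: neq0_dnorm_gt0.
Qed.

HB.instance Definition _ dot :=
  isDotProduct.Build R {ffun 'I_m -> X} (prod_dot dot) (@prod_dot_gt0 dot).

(* (x_1, ..., x_m) |-> (x_m, x_1, ..., x_{m-1}): ord_pred is the cyclic
   predecessor on 'I_m. *)
Definition cyc_shift (x : {ffun 'I_m -> X}) : {ffun 'I_m -> X} :=
  [ffun i => x (ord_pred i)].

Definition id_sub_shift : {ffun 'I_m -> X} -> set {ffun 'I_m -> X} :=
  op_of_fun (fun x => x - cyc_shift x).

Definition diag_subspace : set {ffun 'I_m -> X} :=
  [set [ffun=> a] | a in [set: X]].

Definition sep_sum (f : 'I_m -> X -> \bar R) (x : {ffun 'I_m -> X}) : \bar R :=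
  (\sum_(i < m) f i (x i))%E.

Definition classical_cycles dot (f : 'I_m -> X -> \bar R) :
    set {ffun 'I_m -> X} :=
  [set x | minkowski_sum (subdiff (prod_dot dot) (sep_sum f) x)
                         (id_sub_shift x) 0].

Definition classical_gap_vectors dot (f : 'I_m -> X -> \bar R) :
    set {ffun 'I_m -> X} :=
  [set y | minkowski_sum (op_inv (subdiff (prod_dot dot) (sep_sum f)) y)
                         (op_inv id_sub_shift y) 0].

End ProductSpace.
Arguments id_sub_shift {R X m}.
Arguments diag_subspace {R X m}.

(* Main.v *)
Require Import Defs.
From mathcomp Require Import all_boot all_order all_algebra sesquilinear.
From mathcomp Require Import all_classical all_reals all_analysis.
From mathcomp Require Import ring lra.
Import Order.TTheory GRing.Theory Num.Theory.
Import numFieldNormedType.Exports.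
Local Open Scope classical_set_scope.
Local Open Scope ring_scope.

(** Write [S] for the cyclic shift and [F] for the separable sum of the [f i].
Unfolding the definitions, [x] is a cycle iff [S x - x] is a subgradient of [F]
at [x] ([classical_cyclesP]), and the gap vectors are the displacements [S x - x]
of the cycles ([classical_gap_vectorsE]).  The two set equalities follow.

Uniqueness of the gap vector is a tension between two facts.  Let [x] and [z] be
cycles and [w = x - z].  The subdifferential of a proper function is monotone
([subdiff_monotone]), so [<w, S w - w> >= 0].  On the other hand [S] permutes the
coordinates, hence is a linear isometry, and expanding the square gives
[2 <w, S w - w> = - |S w - w|^2 <= 0] ([prod_dot_shift_displacement]).  Thus
[S w - w = 0], that is, [S x - x = S z - z].  Gap vectors are orthogonal to the
diagonal because [S] is an isometry that fixes constant vectors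
([shift_displacement_ortho_diag]). *)

Section Subdifferential.
Set Implicit Arguments.
Unset Strict Implicit.
Variables (R : realType) (E : lmodType R) (dot : {dot E for idfun}).
Variables (g : E -> \bar R) (g_proper : proper_fun g).

(** The subgradient inequality at [x], tested at a point where [g] is finite,
bounds [g x] from above. *)
Lemma subdiff_fin_num x u : subdiff dot g x u -> g x \is a fin_num.
Proof.
case: g_proper => gNy [p gp] /(_ p) /le_lt_trans /(_ gp).
rewrite fin_numE gNy /=; case: (g x) => //=.
Qed.

(** Adding the two subgradient inequalities cancels the values of [g], which
requires them to be finite. *)
Lemma subdiff_monotone x y u v :
  subdiff dot g x u -> subdiff dot g y v -> 0 <= dot (x - y) (u - v).
Proof.
move=> xu yv.
have gx := subdiff_fin_num xu; have gy := subdiff_fin_num yv.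
have := xu y; have := yv x.
rewrite -(fineK gx) -(fineK gy) -!EFinD !lee_fin => yvx xuy.
have -> : dot (x - y) (u - v) = - dot (y - x) u - dot (x - y) v.
  by rewrite linearBr -(opprB x y) linearNl opprK.
lra.
Qed.

End Subdifferential.

Section CyclicShift.
Set Implicit Arguments.
Unset Strict Implicit.
Variables (R : realType) (X : lmodType R) (m : nat) (dot : {dot X for idfun}).
Implicit Types x y w : {ffun 'I_m -> X}.

Lemma cyc_shiftB x y : cyc_shift (x - y) = cyc_shift x - cyc_shift y.
Proof. by apply/ffunP => i; rewrite !ffunE. Qed.

Lemma cyc_shiftN x : cyc_shift (- x) = - cyc_shift x.
Proof. by apply/ffunP => i; rewrite !ffunE. Qed.

Lemma prod_dotC x y : prod_dot dot x y = prod_dot dot y x.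
Proof. by rewrite prod_dot_sym expr0 mul1r. Qed.

Lemma prod_dot_cyc_shift x y :
  prod_dot dot (cyc_shift x) (cyc_shift y) = prod_dot dot x y.
Proof.
rewrite /prod_dot [RHS](reindex_inj (@ord_pred_inj m)).
by apply: eq_bigr => i _; rewrite !ffunE.
Qed.

(** The polarization identity [2 <w, v - w> = |v|^2 - |w|^2 - |v - w|^2] for
[v = S w], [S] the cyclic shift, in which the isometry cancels the first two squares. *)
Lemma prod_dot_shift_displacement w (d := cyc_shift w - w) :
  prod_dot dot w d *+ 2 = - prod_dot dot d d.
Proof.
rewrite /d !(linearBr, linearBl) /= prod_dot_cyc_shift.
rewrite (prod_dotC (cyc_shift w) w); ring.
Qed.

Lemma shift_displacement_eq0 w :
  0 <= prod_dot dot w (cyc_shift w - w) -> cyc_shift w - w = 0.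
Proof.
move=> w_ge0; apply/eqP; apply: contraTT w_ge0 => /(prod_dot_gt0 dot) d_gt0.
by rewrite -ltNge -(pmulrn_llt0 _ (ltn0Sn 1)) prod_dot_shift_displacement oppr_lt0.
Qed.

(** The shift fixes constant vectors, so a constant vector has the same inner
product with [x] and with its shift. *)
Lemma shift_displacement_ortho_diag x :
  ortho_compl (prod_dot dot) diag_subspace (cyc_shift x - x).
Proof.
move=> _ [a _ <-].
have a_fix : cyc_shift [ffun=> a] = [ffun=> a] :> {ffun 'I_m -> X}.
  by apply/ffunP => i; rewrite !ffunE.
by rewrite linearBr /= -{1}a_fix prod_dot_cyc_shift subrr.
Qed.

End CyclicShift.

Section Cycles.
Set Implicit Arguments.
Unset Strict Implicit.
Variables (R : realType) (X : lmodType R) (m : nat) (dot : {dot X for idfun}).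
Variable f : 'I_m -> X -> \bar R.
Implicit Types x y z : {ffun 'I_m -> X}.

Lemma sep_sum_proper :
  (forall i, proper_fun (f i)) -> proper_fun (sep_sum f).
Proof.
move=> f_proper; split=> [x|].
  rewrite esum_eqNy; apply/existsPn => i.
  by case: (f_proper i) => fNy _; apply: fNy.
have /choice[p fp] : forall i, exists a : X, (f i a < +oo)%E.
  by move=> i; case: (f_proper i).
by exists [ffun i => p i]; apply: lte_sum_pinfty => i _; rewrite ffunE.
Qed.

Lemma classical_cyclesP x :
  classical_cycles dot f x <->
  subdiff (prod_dot dot) (sep_sum f) x (cyc_shift x - x).
Proof.
split=> [[u xu [_ ->]] /eqP|xu].
  by rewrite addr_eq0 opprB => /eqP <-.
exists (cyc_shift x - x) => //; exists (x - cyc_shift x) => //.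
by rewrite addrA subrK subrr.
Qed.

(** In [0 = x + b] with [y = b - S b], [S] the cyclic shift, the point [b] has to
be [- x], whence [y = S x - x] by linearity. *)
Lemma classical_gap_vectorsE :
  classical_gap_vectors dot f =
  [set cyc_shift x - x | x in classical_cycles dot f].
Proof.
apply/seteqP; split=> [y [x xy [b bE]]|_ [x /classical_cyclesP xZ <-]].
  move=> /eqP; rewrite addrC addr_eq0 => /eqP b_opp.
  have yE : cyc_shift x - x = y.
    by rewrite bE b_opp cyc_shiftN opprK addrC.
  by exists x => //; apply/classical_cyclesP; rewrite yE.
exists x => //; exists (- x); last by rewrite subrr.
by rewrite /op_inv /= /id_sub_shift /op_of_fun /= cyc_shiftN opprK addrC.
Qed.

(** Monotonicity makes [<w, S w - w>] nonnegative for [w = x - z], where [S] is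
the cyclic shift, and only vectors fixed by [S] allow this. *)
Lemma cycles_same_gap x z : (forall i, proper_fun (f i)) ->
  classical_cycles dot f x -> classical_cycles dot f z ->
  cyc_shift x - x = cyc_shift z - z.
Proof.
move=> /sep_sum_proper f_proper /classical_cyclesP xZ /classical_cyclesP zZ.
have := subdiff_monotone f_proper xZ zZ.
have dE : cyc_shift x - x - (cyc_shift z - z) = cyc_shift (x - z) - (x - z).
  by rewrite cyc_shiftB !opprB addrACA [RHS]addrACA [- x + _]addrC.
rewrite dE => /shift_displacement_eq0; rewrite -dE.
by move/eqP; rewrite subr_eq0 => /eqP.
Qed.

End Cycles.

Theorem proposition3p4 (R : realType) (X : completeNormedModType R)
    (dot : {dot X for idfun}) (dot_norm : forall x : X, dot x x = `|x| ^+ 2)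
    (m : nat) (m_gt0 : (0 < m)%N) (f : 'I_m -> X -> \bar R)
    (f_proper : forall i, proper_fun (f i))
    (f_lsc : forall i, lower_semicontinuous (f i))
    (f_convex : forall i, econvex_fun (f i))
    (standing : edom (fenchel_conj (prod_dot dot) (sep_sum f))
                `&` ortho_compl (prod_dot dot) diag_subspace !=set0) :
  let Z := classical_cycles dot f in
  let G := classical_gap_vectors dot f in
  let df := subdiff (prod_dot dot) (sep_sum f) in
  Z = \bigcup_(y in G) (op_inv id_sub_shift (- y) `&` op_inv df y)
  /\ G = [set cyc_shift x - x | x in Z]
  /\ (G !=set0 ->
      exists y : {ffun 'I_m -> X},
        [/\ G = [set y],
            ortho_compl (prod_dot dot) diag_subspace y
          & forall x, Z x -> y = cyc_shift x - x]).
Proof.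
move=> Z G df; have GE : G = [set cyc_shift x - x | x in Z].
  exact: classical_gap_vectorsE.
split; [|split=> //].
  apply/seteqP; split=> [x xZ|x [y _] [/= yE xy]].
    exists (cyc_shift x - x); first by rewrite GE; exists x.
    by split; [rewrite /op_inv /= opprB | apply/classical_cyclesP].
  apply/classical_cyclesP.
  have -> : cyc_shift x - x = y by rewrite -[y]opprK yE opprB.
  exact: xy.
rewrite GE => -[_ [x xZ _]]; exists (cyc_shift x - x); split.
- apply/seteqP; split=> [_ [z zZ <-]|_ ->]; last by exists x.
  exact: cycles_same_gap f_proper zZ xZ.
- exact: shift_displacement_ortho_diag.
- by move=> z zZ; apply: cycles_same_gap f_proper xZ zZ.
Qed.
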